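(* Let $\mathcal F$ be a pro-saturated pro-fusion system on the infinite dihedral pro-$2$ group $D_{2^\infty}$. Then $\mathcal F=\mathcal F_{D_{2^\infty}}(D_{2^\infty})$.
   Context: $D_{2^\infty}=\varprojlim_n D_{2^n}$ where $D_{2^n}=\langle a,b\mid a^{2^n},b^2,baba\rangle$, with natural projections. A fusion system on a finite $p$-group $P$ is a category whose objects are the subgroups of $P$ and whose morphism sets $\mathrm{Hom}_{\mathcal F}(R,S)$ consist of injective group homomorphisms $R\to S$, subject to the usual axioms (containing all homomorphisms induced by conjugation in $P$; each morphism $\varphi:R\to S$ induces an isomorphism $R\to\varphi(R)$ in the category with inverse also in the category); ''saturated'' is meant in the standard sense. A morphism of fusion systems from $\mathcal F$ on $P$ to $\mathcal F'$ on $P'$ is a pair $(\alpha,\Phi)$ with $\alpha:P\to P'$ a homomorphism and $\Phi:\mathcal F\to\mathcal F'$ a functor such that $\Phi(R)=\alpha(R)$ for all $R\le P$ and $\Phi(\varphi)\circ\alpha=\alpha\circ\varphi$ for all morphisms $\varphi$. Let $P=\varprojlim_{i\in I}P_i$ be a pro-$p$ group with $I$ directed and each $P_i$ a finite $p$-group, and let $\mathcal F_i$ be fusion systems on $P_i$ forming an inverse system. The category $\varprojlim_i\mathcal F_i$ has as objects the closed subgroups of $P$, and $\mathrm{Hom}(R,S)=\varprojlim_i\mathrm{Hom}_{\mathcal F_i}(R_i,S_i)$, where $R_i,S_i$ are the images of $R,S$ in $P_i$. A category obtained in this way is called a pro-fusion system on $P$. Morphisms of pro-fusion systems are defined like morphisms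 of fusion systems, using continuous homomorphisms and closed subgroups. A pro-fusion system is pro-saturated if it is isomorphic to an inverse limit of saturated fusion systems on finite $p$-groups. For a pro-$p$ group $D$, $\mathcal F_D(D)$ is the pro-fusion system whose objects are the closed subgroups of $D$ and whose morphisms $R\to S$ are the homomorphisms induced by conjugation by elements $g\in D$ with $R^g\le S$. *)

(* Defs.v *)
From HB Require Import structures.
From mathcomp Require Import all_boot all_order all_algebra all_fingroup.
From mathcomp Require Import all_solvable.
From mathcomp Require Import all_classical topology.

Set Implicit Arguments.
Unset Strict Implicit.
Unset Printing Implicit Defensive.

Local Open Scope classical_set_scope.
Local Open Scope group_scope.

HB.mixin Record isTopologicalGroup G of Topological G & monoid.Group G := {
  mulg_continuous : continuous (fun x : G * G => x.1 * x.2);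
  invg_continuous : continuous (fun x : G => x^-1)
}.

#[short(type="topologicalGroupType")]
HB.structure Definition TopologicalGroup :=
  {G of Topological G & monoid.Group G & isTopologicalGroup G}.

Record closed_subgroup (P : topologicalGroupType) := ClosedSubgroup {
  cs_set :> set P;
  cs_closed : closed cs_set;
  cs_one : cs_set 1;
  cs_mul : forall x y, cs_set x -> cs_set y -> cs_set (x * y);
  cs_inv : forall x, cs_set x -> cs_set x^-1
}.

(* A family [O] of subgroups of [G], each presented by its type of elements
   together with the inclusion into [G]. *)
Record subgroup_family (G : Type) := SubgroupFamily {
  obj :> Type;
  el : obj -> Type;
  inc : forall R : obj, el R -> G
}.
Arguments inc {G s R}.

Definition subgroups (gT : finGroupType) : subgroup_family gT :=
  @SubgroupFamily gT {group gT} (fun R => subg_of R) (fun R => @sgval gT R).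

Definition closed_subgroups (P : topologicalGroupType) : subgroup_family P :=
  @SubgroupFamily P (closed_subgroup P) (fun R => {x : P | x \in cs_set R})
    (fun R => sval).

(* A morphism is determined by its source, its target and the underlying map,
   so [Hom R S] is a set of maps. *)
Record subgroup_category (G : Type) (O : subgroup_family G) :=
  SubgroupCategory {
  hom : forall R S : O, set (el R -> el S);
  hom_id : forall R : O, hom (@id (el R));
  hom_comp : forall (R S T : O) (f : el R -> el S) (g : el S -> el T),
    hom f -> hom g -> hom (g \o f)
}.
Arguments hom {G O} s R S.

Record Hom (G : Type) (O : subgroup_family G) (C : subgroup_category O)
    (R S : O) := MkHom {
  hom_fun :> el R -> el S;
  hom_funP : hom C R S hom_fun
}.
Arguments Hom {G O} C R S.

Definition idHom (G : Type) (O : subgroup_family G) (C : subgroup_category O)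
  (R : O) : Hom C R R := MkHom (@hom_id _ _ C R).

Definition compHom (G : Type) (O : subgroup_family G)
    (C : subgroup_category O) (R S T : O)
    (g : Hom C S T) (f : Hom C R S) : Hom C R T :=
  MkHom (hom_comp (hom_funP f) (hom_funP g)).

(* Equality of two maps whose sources (and targets) are equal as subgroups
   only up to a propositional equality. *)
Definition same_map (G : Type) (O : subgroup_family G) (R S R' S' : O)
    (f : el R -> el S) (g : el R' -> el S') : Prop :=
  forall (x : el R) (x' : el R'), inc x = inc x' -> inc (f x) = inc (g x').

Definition inverse_homs (G : Type) (O : subgroup_family G)
    (C : subgroup_category O) (R S : O) (f : Hom C R S) (g : Hom C S R) :=
  cancel f g /\ cancel g f.

Record functor (G G' : Type) (O : subgroup_family G)
    (O' : subgroup_family G') (C : subgroup_category O)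
    (C' : subgroup_category O') := Functor {
  fobj :> O -> O';
  functor_map : forall R S : O, Hom C R S -> Hom C' (fobj R) (fobj S);
  functor_map_id : forall R : O, functor_map (idHom C R) =1 id;
  functor_map_comp : forall (R S T : O) (g : Hom C S T) (f : Hom C R S),
    functor_map (compHom g f) =1 functor_map g \o functor_map f
}.
Arguments functor_map {G G' O O' C C'} f {R S} : rename.

(* The functors Phi such that (alpha, Phi) is a morphism. *)
Record functor_over (G G' : Type) (alpha : G -> G') (O : subgroup_family G)
    (O' : subgroup_family G') (C : subgroup_category O)
    (C' : subgroup_category O') := FunctorOver {
  fo_functor :> functor C C';
  fo_obj : forall R : O,
    range (@inc _ _ (fo_functor R)) = alpha @` range (@inc _ _ R);
  fo_comm : forall (R S : O) (phi : Hom C R S)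
      (x : el R) (y : el (fo_functor R)),
    inc y = alpha (inc x) ->
    inc (functor_map fo_functor phi y) = alpha (inc (phi x))
}.

Record fusion_system (gT : finGroupType) := FusionSystem {
  fs_cat :> subgroup_category (subgroups gT);
  fs_morph : forall (R S : {group gT}) (phi : Hom fs_cat R S),
    {morph (phi : subg_of R -> subg_of S) : x y / x * y};
  fs_inj : forall (R S : {group gT}) (phi : Hom fs_cat R S), injective phi;
  fs_conj : forall (R S : {group gT}) (phi : subg_of R -> subg_of S) (g : gT),
    (forall x, sgval (phi x) = sgval x ^ g) -> hom fs_cat R S phi;
  fs_iso : forall (R S : {group gT}) (phi : Hom fs_cat R S),
    exists (T : {group gT}) (psi : Hom fs_cat R T) (psi' : Hom fs_cat T R),
      inverse_homs psi psi' /\ forall x, sgval (psi x) = sgval (phi x)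
}.

Section Saturation.
Variables (p : nat) (gT : finGroupType) (F : fusion_system gT).
Implicit Types Q R : {group gT}.

Definition F_conjugate Q R : Prop :=
  exists (f : Hom F Q R) (g : Hom F R Q), inverse_homs f g.

Definition fully_normalized Q : Prop :=
  forall R, F_conjugate Q R -> (#|'N(R)| <= #|'N(Q)|)%N.

Definition fully_centralized Q : Prop :=
  forall R, F_conjugate Q R -> (#|'C(R)| <= #|'C(Q)|)%N.

(* [Aut Q] consists of permutations of the whole group which fix the elements
   outside of [Q]. *)
Definition AutF Q : {set {perm gT}} :=
  [set s in Aut Q |
    `[< exists f : Hom F Q Q, forall x, sgval (f x) = s (sgval x) >]]%SET.

Definition AutP Q : {set {perm gT}} := conj_aut Q @* 'N(Q).

(* N_phi: the g in N_P(Q) such that phi c_g phi^-1 is conjugation by some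
   element of N_P(R), for an isomorphism phi : Q -> R. *)
Definition extender Q R (phi : Hom F Q R) : {set gT} :=
  [set g in 'N(Q) | [exists h in 'N(R),
    [forall x : subg_of Q, forall y : subg_of Q,
      (sgval y == sgval x ^ g) ==>
        (sgval (phi y) == sgval (phi x) ^ h)]]]%SET.

Lemma extenderP Q R (phi : Hom F Q R) g :
  reflect (g \in 'N(Q) /\ exists2 h, h \in 'N(R) &
     forall x y : subg_of Q, sgval y = sgval x ^ g ->
       sgval (phi y) = sgval (phi x) ^ h)
    (g \in extender phi).
Proof.
rewrite [X in reflect _ X]finset.in_set; apply: (iffP andP) => -[NQg].
  move=> /existsP[h /andP[NRh /forallP H]]; split=> //; exists h => // x y.
  by move=> /eqP; move/forallP: (H x) => /(_ y) /implyP H' /H' /eqP.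
case=> h NRh H; split=> //; apply/existsP; exists h; rewrite NRh /=.
by apply/forallP=> x; apply/forallP=> y; apply/implyP=> /eqP/H/eqP.
Qed.

Lemma extender_group_set Q R (phi : Hom F Q R) : group_set (extender phi).
Proof.
apply/group_setP; split=> [|g1 g2].
  apply/extenderP; split; first exact: group1.
  exists 1; first exact: group1.
  by move=> x y; rewrite !conjg1 => /val_inj ->.
move=> /extenderP[N1 [h1 M1 H1]] /extenderP[N2 [h2 M2 H2]].
apply/extenderP; split; first exact: groupM.
exists (h1 * h2); first exact: groupM.
move=> x y; rewrite conjgM => yE.
have xg1 : sgval x ^ g1 \in Q by rewrite memJ_norm ?subgP.
have zE : sgval (subg Q (sgval x ^ g1)) = sgval x ^ g1 by rewrite subgK.
by rewrite (H2 (subg Q (sgval x ^ g1)) y) ?zE // (H1 x _ zE) conjgM.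
Qed.

Canonical extender_group Q R (phi : Hom F Q R) :=
  Group (extender_group_set phi).

(* The definition of Broto, Levi and Oliver. *)
Definition saturated : Prop :=
  (forall Q, fully_normalized Q ->
     fully_centralized Q /\ p.-Sylow(AutF Q) (AutP Q)) /\
  (forall Q R (phi : Hom F Q R) (psi : Hom F R Q), inverse_homs phi psi ->
     fully_centralized R ->
     exists phi' : Hom F (extender_group phi) [set: gT]%G, same_map phi phi').

End Saturation.

Definition directed (d : Order.disp_t) (I : preorderType d) : Prop :=
  inhabited I /\ forall i j : I, exists k : I, (i <= k)%O /\ (j <= k)%O.

Record inverse_system (d : Order.disp_t) (I : preorderType d) :=
  InverseSystem {
  is_grp :> I -> finGroupType;
  is_map : forall i j : I, (i <= j)%O ->
    {morphism [set: is_grp j]%SET >-> is_grp i};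
  is_map_id : forall (i : I) (le_ii : (i <= i)%O) (x : is_grp i),
    is_map le_ii x = x;
  is_map_comp : forall (i j k : I) (le_ij : (i <= j)%O) (le_jk : (j <= k)%O)
    (le_ik : (i <= k)%O) (x : is_grp k),
    is_map le_ij (is_map le_jk x) = is_map le_ik x
}.
Arguments is_map {d I} P {i j} : rename.

Section InverseLimit.
Variables (d : Order.disp_t) (I : preorderType d) (P : inverse_system I).

Definition prod_grp : Type := prod_topology (fun i => discrete_topology (P i)).

HB.instance Definition _ := Topological.on prod_grp.

Let pmul (x y : prod_grp) : prod_grp := fun i => (x i : P i) * y i.
Let pinv (x : prod_grp) : prod_grp := fun i => (x i : P i)^-1.
Let pone : prod_grp := fun i => (1 : P i).

Fact prod_grp_mulA : associative pmul.
Proof.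
by move=> x y z; apply: functional_extensionality_dep => i; exact: mulgA.
Qed.
Fact prod_grp_mul1 : left_id pone pmul.
Proof.
by move=> x; apply: functional_extensionality_dep => i; exact: mul1g.
Qed.
Fact prod_grp_mulr1 : right_id pone pmul.
Proof.
by move=> x; apply: functional_extensionality_dep => i; exact: mulg1.
Qed.
Fact prod_grp_mulV : left_inverse pone pinv pmul.
Proof.
by move=> x; apply: functional_extensionality_dep => i; exact: mulVg.
Qed.
Fact prod_grp_mulrV : right_inverse pone pinv pmul.
Proof.
by move=> x; apply: functional_extensionality_dep => i; exact: mulgV.
Qed.

HB.instance Definition _ := isGroup.Build prod_grp
  prod_grp_mulA prod_grp_mul1 prod_grp_mulr1 prod_grp_mulV prod_grp_mulrV.

Definition invlim_set : set prod_grp :=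
  [set x | forall (i j : I) (le_ij : (i <= j)%O), is_map P le_ij (x j) = x i].

Definition invlim : Type := set_type invlim_set.

HB.instance Definition _ := Topological.on invlim.
HB.instance Definition _ := SubChoice.on invlim.

Fact invlim_group_closed : group_closed (fun x : prod_grp => x \in invlim_set).
Proof.
split; first by rewrite inE => i j le_ij; exact: morph1.
move=> x y; rewrite !inE => Lx Ly i j le_ij.
by rewrite morphM ?inE // morphV ?inE // Lx Ly.
Qed.

HB.instance Definition _ :=
  SubChoice_isSubGroup.Build prod_grp (fun x => x \in invlim_set) invlim
    invlim_group_closed.

Definition invlim_proj (i : I) (x : invlim) : P i := (\val x : prod_grp) i.

Lemma invlim_projM i : {morph invlim_proj i : x y / x * y}.
Proof. by move=> x y. Qed.

Lemma open_invlim_proj i (A : set (P i)) : open (invlim_proj i @^-1` A).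
Proof.
have cont : continuous ((fun f : prod_grp => f i) 
  : prod_grp -> discrete_topology (P i)).
  exact: (@proj_continuous _ (fun i => discrete_topology (P i)) i).
have cont' : continuous (\val : invlim -> prod_grp).
  exact: initial_continuous.
have oA : open (A : set (discrete_topology (P i))) by exact: discrete_open.
move/continuousP: cont => /(_ _ oA) oA'.
by move/continuousP: cont' => /(_ _ oA').
Qed.

Lemma invlim_continuousP (T : topologicalType) (f : T -> invlim) :
  (forall i (A : set (P i)), open (f @^-1` (invlim_proj i @^-1` A))) ->
  continuous f.
Proof.
move=> fP; apply: continuous_comp_initial => t.
apply/cvg_sup => i; move: t.
apply/(@continuousP _ (initial_topology _)) => _ [B oB <-].
exact: (fP i B).
Qed.

Fact invlim_mulg_continuous : continuous (fun x : invlim * invlim => x.1 * x.2).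
Proof.
apply: invlim_continuousP => i A; rewrite openE => -[x y] Axy.
exists (invlim_proj i @^-1` [set invlim_proj i x],
        invlim_proj i @^-1` [set invlim_proj i y]).
  by split; apply: open_nbhs_nbhs; split=> //; exact: open_invlim_proj.
move=> [x' y'] /= [xE yE]; rewrite /preimage /= invlim_projM.
by rewrite xE yE -invlim_projM.
Qed.

Fact invlim_invg_continuous : continuous (fun x : invlim => x^-1).
Proof.
apply: invlim_continuousP => i A.
exact: (@open_invlim_proj i [set x | A x^-1]).
Qed.

HB.instance Definition _ := isTopologicalGroup.Build invlim
  invlim_mulg_continuous invlim_invg_continuous.

Definition image_set (i : I) (R : closed_subgroup invlim) : {set P i} :=
  [set y | `[< (invlim_proj i @` R) y >]]%SET.

Lemma image_setP i (R : closed_subgroup invlim) y :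
  reflect ((invlim_proj i @` R) y) (y \in image_set i R).
Proof. by rewrite finset.in_set; exact: asboolP. Qed.

Fact image_group_set i (R : closed_subgroup invlim) :
  group_set (image_set i R).
Proof.
apply/group_setP; split.
  by apply/image_setP; exists 1; [exact: cs_one|].
move=> _ _ /image_setP[x Rx <-] /image_setP[y Ry <-].
by apply/image_setP; exists (x * y); [exact: cs_mul|].
Qed.

Canonical image_group i R := Group (image_group_set i R).

Fact mem_image_group i (R : closed_subgroup invlim)
  (x : el (R : closed_subgroups invlim)) :
  invlim_proj i (inc x) \in image_group i R.
Proof.
by apply/image_setP; exists (inc x) => //; apply/set_mem; exact: (svalP x).
Qed.

Definition to_image i (R : closed_subgroups invlim) (x : el R) :
  subg_of (image_group i R) := Subg (mem_image_group i x).

End InverseLimit.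

(* The composition laws of the functors are stated for completeness: a functor
   over a given homomorphism is unique. *)
Record fusion_inverse_system (d : Order.disp_t) (I : preorderType d)
    (P : inverse_system I) := FusionInverseSystem {
  fis_sys :> forall i : I, fusion_system (P i);
  fis_fun : forall (i j : I) (le_ij : (i <= j)%O),
    functor_over (is_map P le_ij) (fis_sys j) (fis_sys i);
  fis_id : forall (i : I) (le_ii : (i <= i)%O) (R S : {group P i})
      (phi : Hom (fis_sys i) R S),
    same_map (functor_map (fis_fun le_ii) phi) phi;
  fis_comp : forall (i j k : I) (le_ij : (i <= j)%O) (le_jk : (j <= k)%O)
      (le_ik : (i <= k)%O) (R S : {group P k}) (phi : Hom (fis_sys k) R S),
    same_map (functor_map (fis_fun le_ij) (functor_map (fis_fun le_jk) phi))
             (functor_map (fis_fun le_ik) phi)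
}.
Arguments fis_fun {d I P} f {i j} : rename.

Section FusionLimit.
Variables (d : Order.disp_t) (I : preorderType d) (P : inverse_system I).
Variable F : fusion_inverse_system P.
Implicit Types R S T : closed_subgroups (invlim P).

(* The elements of the inverse limit of the sets Hom_(F_i)(R_i, S_i). *)
Record lim_Hom R S := LimHom {
  lim_fam :> forall i : I, Hom (F i) (image_group i R) (image_group i S);
  lim_famP : forall (i j : I) (le_ij : (i <= j)%O),
    same_map (functor_map (fis_fun F le_ij) (lim_fam j)) (lim_fam i)
}.

(* The map R -> S induced by an element of [lim_Hom R S]; as R and S are
   closed, i.e. are the limits of the R_i and of the S_i, every element of
   [lim_Hom R S] induces exactly one map. *)
Definition induces R S (fam : lim_Hom R S) (phi : el R -> el S) : Prop :=
  forall i x, to_image i (phi x) = fam i (to_image i x).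

Definition lim_hom R S : set (el R -> el S) :=
  [set phi | exists fam : lim_Hom R S, induces fam phi].

Fact lim_hom_id R : @lim_hom R R id.
Proof.
have famP (i j : I) (le_ij : (i <= j)%O) :
  same_map (functor_map (fis_fun F le_ij) (idHom (F j) (image_group j R)))
           (idHom (F i) (image_group i R)).
  by move=> x x' xx'; rewrite functor_map_id.
by exists (LimHom famP) => i x.
Qed.

Fact lim_hom_comp R S T (f : el R -> el S) (g : el S -> el T) :
  lim_hom f -> lim_hom g -> lim_hom (g \o f).
Proof.
move=> [famf fP] [famg gP].
have famP (i j : I) (le_ij : (i <= j)%O) :
    same_map (functor_map (fis_fun F le_ij) (compHom (famg j) (famf j)))
             (compHom (famg i) (famf i)).
  move=> x x' xx'; rewrite functor_map_comp /=.
  exact: (lim_famP famg (lim_famP famf xx')).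
by exists (LimHom famP) => i x /=; rewrite gP fP.
Qed.

Definition lim_category : subgroup_category (closed_subgroups (invlim P)) :=
  SubgroupCategory lim_hom_id lim_hom_comp.

End FusionLimit.

Section ProFusion.
Variables (P P' : topologicalGroupType).
Variables (F : subgroup_category (closed_subgroups P)).
Variables (F' : subgroup_category (closed_subgroups P')).

Record pro_morphism := ProMorphism {
  pm_map :> P -> P';
  pm_morph : {morph pm_map : x y / x * y};
  pm_continuous : continuous pm_map;
  pm_fun : functor_over pm_map F F'
}.

End ProFusion.

Definition pro_cancel (P P' : topologicalGroupType)
    (F : subgroup_category (closed_subgroups P))
    (F' : subgroup_category (closed_subgroups P'))
    (a : pro_morphism F F') (b : pro_morphism F' F) : Prop :=
  [/\ cancel a b,
      forall R, pm_fun b (pm_fun a R) = R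
    & forall R S (phi : Hom F R S),
        same_map (functor_map (pm_fun b) (functor_map (pm_fun a) phi)) phi].

Definition pro_isomorphic (P P' : topologicalGroupType)
    (F : subgroup_category (closed_subgroups P))
    (F' : subgroup_category (closed_subgroups P')) : Prop :=
  exists (a : pro_morphism F F') (b : pro_morphism F' F),
    pro_cancel a b /\ pro_cancel b a.

(* The identification of [P] with the limit of the [Q i] is a part of the
   data: it is the isomorphism of topological groups underlying
   [pro_isomorphic]. *)
Definition pro_fusion_system (p : nat) (P : topologicalGroupType)
    (F : subgroup_category (closed_subgroups P)) : Prop :=
  exists (d : Order.disp_t) (I : preorderType d) (Q : inverse_system I)
      (FQ : fusion_inverse_system Q),
    [/\ directed I, forall i : I, p.-group [set: Q i]%SET
      & pro_isomorphic F (lim_category FQ)].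

Definition pro_saturated (p : nat) (P : topologicalGroupType)
    (F : subgroup_category (closed_subgroups P)) : Prop :=
  exists (d : Order.disp_t) (I : preorderType d) (Q : inverse_system I)
      (FQ : fusion_inverse_system Q),
    [/\ directed I,
        forall i : I, p.-group [set: Q i]%SET /\ saturated p (FQ i)
      & pro_isomorphic F (lim_category FQ)].

Section ConjugationCategory.
Variable D : topologicalGroupType.
Implicit Types R S T : closed_subgroups D.

Definition conj_hom R S : set (el R -> el S) :=
  [set phi | exists g : D,
     (forall x, cs_set R x -> cs_set S (x ^ g)) /\
     (forall x : el R, inc (phi x) = inc x ^ g)].

Fact conj_hom_id R : @conj_hom R R id.
Proof. by exists 1; split=> x; rewrite conjg1. Qed.

Fact conj_hom_comp R S T (f : el R -> el S) (g : el S -> el T) :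
  conj_hom f -> conj_hom g -> conj_hom (g \o f).
Proof.
move=> [u [RSu fE]] [v [STv gE]]; exists (u * v); split=> x.
  by move=> Rx; rewrite conjgM; exact/STv/RSu.
by rewrite -[LHS]/(inc (g (f x))) gE fE conjgM.
Qed.

Definition conj_category : subgroup_category (closed_subgroups D) :=
  SubgroupCategory conj_hom_id conj_hom_comp.

End ConjugationCategory.

(* [D_(2^n)], of order [2 ^ n.+1]: the pair [(k, e)] is [a ^+ k * b ^+ e],
   with exponents modulo [2 ^ n] and [2]. *)
Definition dihedral2 (n : nat) : Type := ('I_(2 ^ n).-1.+1 * bool)%type.

Section Dihedral.
Variable n : nat.
Local Notation D := (dihedral2 n).

HB.instance Definition _ := Finite.on D.

Definition dih_mul (x y : D) : D :=
  ((if x.2 then x.1 - y.1 else x.1 + y.1)%R, x.2 (+) y.2).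
Definition dih_inv (x : D) : D := ((if x.2 then x.1 else - x.1)%R, x.2).
Definition dih_one : D := (0%R, false).

Fact dih_mulA : associative dih_mul.
Proof.
move=> [k [|]] [l [|]] [m [|]]; congr (_, _) => /=;
  by rewrite ?GRing.opprD ?GRing.opprK ?GRing.addrA.
Qed.

Fact dih_mul1 : left_id dih_one dih_mul.
Proof. by move=> [k e]; congr (_, _); rewrite /= GRing.add0r. Qed.

Fact dih_mulV : left_inverse dih_one dih_inv dih_mul.
Proof.
by move=> [k [|]]; congr (_, _); rewrite /= ?GRing.subrr ?GRing.addNr.
Qed.

HB.instance Definition _ := Finite_isGroup.Build D dih_mulA dih_mul1 dih_mulV.

Definition dih_a : D := (inZp 1, false).
Definition dih_b : D := (0%R, true).

Lemma dih_mulE (x y : D) : x * y = dih_mul x y. Proof. by []. Qed.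

Lemma dih_aX k : dih_a ^+ k = (inZp k, false) :> D.
Proof.
elim: k => [|k IHk]; first by congr (_, _); apply: val_inj; rewrite /= mod0n.
rewrite expgS IHk; congr (_, _); apply: val_inj => /=.
by rewrite modnDm add1n.
Qed.

Lemma dih_eltE (x : D) : x = dih_a ^+ x.1 * dih_b ^+ x.2.
Proof.
case: x => k e; rewrite dih_aX.
have -> : dih_b ^+ e = (0%R, e) by case: e.
by rewrite dih_mulE; congr (_, _); rewrite /= GRing.addr0 valZpK.
Qed.

Lemma dih_relations :
  [/\ dih_a ^+ (2 ^ n) = 1, dih_b ^+ 2 = 1
    & dih_b * dih_a * dih_b * dih_a = 1].
Proof.
have pn : (2 ^ n).-1.+1 = (2 ^ n)%N by rewrite prednK ?expn_gt0.
split; first 1 last.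
- by rewrite expgS expg1 dih_mulE; congr (_, _); rewrite /= GRing.subrr.
- rewrite !dih_mulE; congr (_, _) => /=.
  by rewrite GRing.sub0r GRing.subr0 GRing.addNr.
by rewrite dih_aX; congr (_, _); apply: val_inj; rewrite /= pn modnn.
Qed.

Lemma Grp_dihedral2 :
  [set: D]%SET \isog
    Grp (a : b : a ^+ (2 ^ n), b ^+ 2, b * a * b * a).
Proof.
have pn : (2 ^ n).-1.+1 = (2 ^ n)%N by rewrite prednK ?expn_gt0.
apply: intro_isoGrp => [|rT H].
  apply/existsP; exists (dih_a, dih_b) => /=.
  have [-> -> ->] := dih_relations; rewrite !xpair_eqE !eqxx !andbT.
  apply/eqP/setP => x; rewrite !inE [x]dih_eltE.
  by rewrite groupM ?groupX ?mem_gen // inE cycle_id ?orbT.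
case/existsP=> -[x y] /=; rewrite !xpair_eqE => /and4P[].
move=> /eqP defH /eqP xn /eqP y2 /eqP yxyx.
have xy : x ^ y = x^-1.
  have yV : y^-1 = y by apply/eqP; rewrite eq_invg_mul -y2 expgS expg1.
  by apply: (mulIg x); rewrite conjgE yV mulVg !mulgA.
have xyX k : x ^+ k ^ y = x ^- k by rewrite conjXg xy expgVn.
pose g (z : D) : rT := x ^+ z.1 * y ^+ z.2.
have xmod k : x ^+ (k %% (2 ^ n).-1.+1) = x ^+ k by rewrite pn expg_mod.
have xopp (k : 'I_(2 ^ n).-1.+1) : x ^+ (- k)%R = x ^- k.
  rewrite /= xmod; apply/eqP; rewrite eq_sym eq_invg_mul -expgnDr.
  by rewrite subnKC; [rewrite pn xn | exact: ltnW (ltn_ord k)].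
have gM : {in [set: D]%SET &, {morph g : u v / u * v}}.
  move=> [k e] [l f] _ _; rewrite dih_mulE /g /dih_mul /=.
  have yE : y ^+ (e (+) f) = y ^+ e * y ^+ f.
    by case: e f => [] [] //=; rewrite ?expg0 ?mulg1 ?mul1g // -expgnDr y2.
  rewrite yE !mulgA; congr (_ * _); case: e {yE} => /=.
    rewrite xmod expgnDr (xopp l) expg1 -mulgA.
    rewrite [x ^- l * y]conjgC conjVg xyX invgK.
    by rewrite mulgA.
  by rewrite xmod expgnDr expg0 !mulg1.
apply/homgP; exists (Morphism gM); apply/eqP; rewrite finset.eqEsubset.
apply/andP; split.
  apply/fintype.subsetP => _ /morphimP[z _ _ ->] /=; rewrite -defH.
  by rewrite groupM ?groupX ?mem_gen // inE cycle_id ?orbT.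
rewrite -defH join_subG !cycle_subG; apply/andP; split.
  apply/morphimP; exists dih_a; rewrite ?inE //.
  by rewrite /= /g /= xmod expg0 mulg1 expg1.
by apply/morphimP; exists dih_b; rewrite ?inE //= /g /= expg0 mul1g expg1.
Qed.

End Dihedral.

Definition dih_proj (n m : nat) (x : dihedral2 m) : dihedral2 n :=
  (inZp x.1, x.2).

Fact inZp_inZp (n m k : nat) : (n <= m)%O ->
  inZp (inZp k : 'I_(2 ^ m).-1.+1) = inZp k :> 'I_(2 ^ n).-1.+1.
Proof.
move=> le_nm; apply: val_inj => /=; rewrite !prednK ?expn_gt0 //.
by rewrite modn_dvdm // dvdn_exp2l.
Qed.

Fact dih_projM (n m : nat) : (n <= m)%O ->
  {in [set: dihedral2 m]%SET &, {morph @dih_proj n m : x y / x * y}}.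
Proof.
move=> le_nm [k e] [l f] _ _; rewrite !dih_mulE.
have inZpD (u v : 'I_(2 ^ m).-1.+1) :
    inZp (u + v)%R = (inZp u + inZp v)%R :> 'I_(2 ^ n).-1.+1.
  rewrite (inZp_inZp (u + v) le_nm); apply: val_inj => /=.
  by rewrite modnDm.
have inZpN (u : 'I_(2 ^ m).-1.+1) :
    inZp (- u)%R = (- inZp u)%R :> 'I_(2 ^ n).-1.+1.
  apply/eqP; rewrite -GRing.addr_eq0 -inZpD GRing.addNr.
  by apply/eqP/val_inj; rewrite /= mod0n.
case: e; congr (_, _); last exact: inZpD.
by apply: etrans (inZpD k (- l)%R) _; rewrite inZpN.
Qed.

Definition dih_projm (n m : nat) (le_nm : (n <= m)%O) :
    {morphism [set: dihedral2 m]%SET >-> dihedral2 n} :=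
  Morphism (dih_projM le_nm).

Lemma dih_proj_a (n m : nat) : (n <= m)%O -> dih_proj n (dih_a m) = dih_a n.
Proof. by move=> le_nm; congr (_, _); exact: inZp_inZp. Qed.

Lemma dih_proj_b (n m : nat) : dih_proj n (dih_b m) = dih_b n.
Proof. by congr (_, _); apply: val_inj; rewrite /= mod0n. Qed.

Fact dih_projm_id (n : nat) (le_nn : (n <= n)%O) (x : dihedral2 n) :
  dih_projm le_nn x = x.
Proof. by case: x => k e; congr (_, _); exact: valZpK. Qed.

Fact dih_projm_comp (n m l : nat) (le_nm : (n <= m)%O) (le_ml : (m <= l)%O)
    (le_nl : (n <= l)%O) (x : dihedral2 l) :
  dih_projm le_nm (dih_projm le_ml x) = dih_projm le_nl x.
Proof. by congr (_, _); exact: inZp_inZp. Qed.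

Definition dihedral_system : inverse_system nat :=
  InverseSystem dih_projm_id dih_projm_comp.

Definition D2oo : topologicalGroupType := invlim dihedral_system.

(* Main.v *)
From HB Require Import structures.
From mathcomp Require Import all_boot all_order all_algebra all_fingroup.
From mathcomp Require Import all_solvable.
From mathcomp Require Import all_classical topology.
Require Import Defs.

(** Why the theorem holds.

    Write the pro-saturated system as the limit of saturated systems F_i on
    finite 2-groups Q_i, and let a, b in lim Q_i be the images of the standard
    generators of the infinite dihedral group.  A transition map Q_j -> Q_i
    carries F_j into F_i, so its kernel is strongly closed in F_j
    ([is_map_fibres]).  This is what excludes exotic dihedral fusion: inside a
    dihedral image of Q_j, the kernel of the projection to a smaller quotient
    is a group of rotations which every F_j-morphism preserves, while exotic
    fusion would have to move the central rotation to a reflection.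

    The finite part concerns a saturated system F on a p-group P and a
    homomorphism pi on P with strongly closed kernel.  If all p'-elements of
    all groups Aut_F(S) act trivially modulo ker pi, then every morphism of F
    is, modulo ker pi, conjugation by an element of P
    ([fusion_map_conj_mod]).  This is Alperin's fusion argument: an isomorphism
    from U onto a fully normalized S extends, after correction by an element
    of Aut_F(S), to the normalizer of U ([extend_to_normalizer]); this leaves
    only Aut_F(S), which is the product of its Sylow subgroup Aut_P(S) and the
    subgroup acting trivially modulo ker pi ([AutF_conj_mod]).

    For p = 2 and a dihedral image, the triviality of the odd automorphisms is
    [odd_fusion_auto].  Let Z be the kernel of a further projection rho, its
    preimage in P being strongly closed, and suppose that Z consists of
    rotations, among them some t with t^2 <> 1.  A rotation c lies in Z or has
    t among its powers, because subgroups of a cyclic 2-group form a chain.  In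
    both cases its image is a rotation, since reflections do not centralize the
    image of t ([fusion_rotation]).  So an odd automorphism acts on a cyclic
    2-group of rotations, hence trivially, and then it fixes reflections as
    well.

    The transition maps of the system (Q_i) need not be surjective.  A
    compactness argument with an ultrafilter on the index set
    ([invlim_cofinal]) gives, for every i, an index j such that Q_j and lim Q_i
    have the same, dihedral, image in Q_i ([mittag_leffler]), so the finite
    part applies to Q_j -> Q_i.  The same argument assembles the conjugating
    elements of the finite levels into one element of lim Q_i
    ([lim_hom_conj]). *)

Set Implicit Arguments.
Unset Strict Implicit.
Unset Printing Implicit Defensive.

Import Order.TTheory.

Local Open Scope group_scope.

(** * Morphisms of a fusion system as functions on the ambient group *)

Section FusionMaps.
Variables (gT : finGroupType) (F : fusion_system gT).
Implicit Types (Q R S T U V W : {group gT}) (f g h : gT -> gT).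

(** Functions on the whole group, of which only the values on [U] matter,
    avoid subtypes of the various subgroups when maps are restricted,
    composed and compared. *)
Definition fusion_map U V f : Prop :=
  exists phi : Hom F U V, forall x : subg_of U, sgval (phi x) = f (sgval x).

Lemma hom_fusion_map U V (phi : Hom F U V) :
  fusion_map U V (fun x => sgval (phi (subg U x))).
Proof. by exists phi => x; rewrite sgvalK. Qed.

Lemma fusion_map_mem U V f : fusion_map U V f -> {in U, forall x, f x \in V}.
Proof.
case=> phi phiE x Ux; have := phiE (subg U x); rewrite subgK // => <-.
exact: subgP.
Qed.

Lemma fusion_mapM U V f :
  fusion_map U V f -> {in U &, {morph f : x y / x * y}}.
Proof.
case=> phi phiE x y Ux Uy.
have fE z : z \in U -> sgval (phi (subg U z)) = f z.
  by move=> Uz; rewrite phiE subgK.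
rewrite -!fE ?groupM // subgM //.
exact: (congr1 sgval (fs_morph phi (subg U x) (subg U y))).
Qed.

Lemma fusion_map_inj U V f : fusion_map U V f -> {in U &, injective f}.
Proof.
case=> phi phiE x y Ux Uy fxy.
have: phi (subg U x) = phi (subg U y).
  apply: val_inj.
  change (sgval (phi (subg U x)) = sgval (phi (subg U y))).
  by rewrite !phiE !subgK.
by move/(@fs_inj _ _ _ _ phi)/(congr1 sgval); rewrite !subgK.
Qed.

Lemma fusion_map1 U V f : fusion_map U V f -> f 1 = 1.
Proof.
move/fusion_mapM/(_ 1 1 (group1 _) (group1 _)); rewrite mulg1 => e.
by apply: (mulgI (f 1)); rewrite -e mulg1.
Qed.

Lemma fusion_mapX U V f n :
  fusion_map U V f -> {in U, {morph f : x / x ^+ n}}.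
Proof.
move=> Ff x Ux; elim: n => [|n IH]; first by rewrite !expg0 (fusion_map1 Ff).
by rewrite !expgS (fusion_mapM Ff) ?groupX // IH.
Qed.

Lemma fusion_map_comp U V W f g :
  fusion_map U V f -> fusion_map V W g -> fusion_map U W (g \o f).
Proof.
case=> phi phiE [psi psiE]; exists (compHom psi phi) => x.
by rewrite /= psiE phiE.
Qed.

Lemma fusion_map_conj U V (c : gT) :
  {in U, forall x, x ^ c \in V} -> fusion_map U V (conjg^~ c).
Proof.
move=> UcV.
have cE (x : subg_of U) : sgval (subg V (sgval x ^ c)) = sgval x ^ c.
  by rewrite subgK ?UcV ?subgP.
by exists (MkHom (fs_conj F cE)).
Qed.

Lemma fusion_map_sub U V : U \subset V -> fusion_map U V id.
Proof.
move=> sUV; have [|phi phiE] := @fusion_map_conj U V 1.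
  by move=> x Ux; rewrite conjg1 (fintype.subsetP sUV).
by exists phi => x; rewrite phiE conjg1.
Qed.

Lemma eq_fusion_map U V f g :
  {in U, f =1 g} -> fusion_map U V f -> fusion_map U V g.
Proof. by move=> fg [phi phiE]; exists phi => x; rewrite phiE fg ?subgP. Qed.

Definition fusion_iso U V f g : Prop :=
  [/\ fusion_map U V f, fusion_map V U g, {in U, cancel f g}
    & {in V, cancel g f}].

Lemma fusion_iso_sym U V f g : fusion_iso U V f g -> fusion_iso V U g f.
Proof. by case. Qed.

Lemma fusion_iso_comp U V W f f' g g' :
  fusion_iso U V f f' -> fusion_iso V W g g' ->
  fusion_iso U W (g \o f) (f' \o g').
Proof.
move=> [Ff Ff' fK f'K] [Fg Fg' gK g'K]; split.
- exact: fusion_map_comp Ff Fg.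
- exact: fusion_map_comp Fg' Ff'.
- by move=> x Ux; rewrite /= gK ?fK ?(fusion_map_mem Ff).
- by move=> x Wx; rewrite /= f'K ?g'K ?(fusion_map_mem Fg').
Qed.

Lemma card_fusion_iso U V f g : fusion_iso U V f g -> #|U| = #|V|.
Proof.
move=> fP; suff le A B h h' : fusion_iso A B h h' -> (#|A| <= #|B|)%N.
  apply/eqP; rewrite eqn_leq; apply/andP; split; first exact: le fP.
  exact: le (fusion_iso_sym fP).
case=> Fh _ _ _; rewrite -(card_in_imset (fusion_map_inj Fh)).
apply/subset_leq_card/fintype.subsetP => _ /imsetP[x Ax ->].
exact: fusion_map_mem Ax.
Qed.

Lemma fusion_map_corestr U V f :
  fusion_map U V f -> exists W g, fusion_iso U W f g.
Proof.
case=> phi phiE; have [W [psi [psi' [[psiK psi'K] psiE]]]] := fs_iso phi.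
exists W, (fun x => sgval (psi' (subg W x))); split.
- by exists psi => x; rewrite psiE.
- exact: hom_fusion_map.
- move=> x Ux; have := phiE (subg U x); rewrite subgK // => <-.
  by rewrite -psiE sgvalK psiK subgK.
- by move=> x Wx; rewrite -phiE -psiE psi'K subgK.
Qed.

Lemma F_conjugateP U V :
  F_conjugate F U V <-> exists f g, fusion_iso U V f g.
Proof.
split=> [[phi [psi [phiK psiK]]]|[f [g [[phi phiE] [psi psiE] fK gK]]]].
  exists (fun x => sgval (phi (subg U x))), (fun x => sgval (psi (subg V x))).
  by split; [exact: hom_fusion_map|exact: hom_fusion_map| |];
     move=> x xP; rewrite sgvalK ?phiK ?psiK subgK.
exists phi, psi; split=> x; apply: val_inj.
  by change (sgval (psi (phi x)) = sgval x); rewrite psiE phiE fK ?subgP.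
by change (sgval (phi (psi x)) = sgval x); rewrite phiE psiE gK ?subgP.
Qed.

Lemma ex_fully_normalized U :
  exists S f g, fully_normalized F S /\ fusion_iso U S f g.
Proof.
pose P (S : {group gT}) := `[< exists f g, fusion_iso U S f g >].
have PU : P U.
  by apply/asboolP; exists id, id; split=> //; exact: fusion_map_sub.
case: (@arg_maxnP _ U P (fun S => #|'N(S)|) PU) => S /asboolP[f [g fP]] maxS.
exists S, f, g; split=> // R /F_conjugateP[h [h' hP]]; apply: maxS.
by apply/asboolP; exists (h \o f), (g \o h'); exact: fusion_iso_comp hP.
Qed.

Lemma AutFP S s :
  reflect (s \in Aut S /\ fusion_map S S s) (s \in AutF F S).
Proof.
rewrite [X in reflect _ X]finset.in_set.
by apply: (iffP andP) => -[As H]; split=> //; exact/asboolP.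
Qed.

Fact AutF_group_set S : group_set (AutF F S).
Proof.
apply/group_setP; split=> [|s t /AutFP[As Fs] /AutFP[At Ft]].
  apply/AutFP; split; first exact: group1.
  apply: eq_fusion_map (fusion_map_sub (fintype.subxx _)) => x _.
  by rewrite perm1.
apply/AutFP; split; first exact: groupM.
by apply: eq_fusion_map (fusion_map_comp Fs Ft) => x _; rewrite permM.
Qed.
Canonical AutF_group S := Group (AutF_group_set S).

Lemma fusion_auto S f :
  fusion_map S S f -> exists2 s, s \in AutF F S & {in S, s =1 f}.
Proof.
move=> Ff; have fS : f @: S = S.
  apply/eqP; rewrite eqEcard (card_in_imset (fusion_map_inj Ff)) leqnn andbT.
  apply/fintype.subsetP => _ /imsetP[x Sx ->]; exact: fusion_map_mem Sx.
pose fm := Morphism (fusion_mapM Ff).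
have fm_inj : 'injm fm by apply/injmP; exact: fusion_map_inj Ff.
have fmS : fm @* S = S by rewrite morphimEdom.
exists (aut fm_inj fmS) => [|x Sx]; last by rewrite autE.
apply/AutFP; split; first exact: Aut_aut.
by apply: (eq_fusion_map _ Ff) => x Sx; rewrite autE.
Qed.

Lemma AutPP S s : reflect
  (s \in Aut S /\ exists2 h, h \in 'N(S) & {in S, s =1 conjg^~ h})
  (s \in AutP S).
Proof.
apply: (iffP morphimP) => [[h Nh _ ->]|[As [h Nh sE]]].
  split; first exact: Aut_aut.
  by exists h => // x Sx; rewrite norm_conj_autE.
exists h => //; apply: (eq_Aut As (Aut_aut _ _)) => x Sx.
by rewrite sE // (norm_conj_autE Nh Sx).
Qed.

(** * Alperin's argument modulo a strongly closed kernel *)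

Section Control.
Variable p : nat.
Hypotheses (pgT : p.-group [set: gT]) (satF : saturated p F).

(** Conjugation by elements of ['N(U)] induces, through [f], a [p]-subgroup of
    Aut_F(S).  By Sylow's theorem some [s] conjugates it into Aut_P(S), and
    then all of ['N(U)] lies in the extender of [s \o f]. *)
Lemma extend_to_normalizer U S f f' :
    fully_normalized F S -> fusion_iso U S f f' ->
  exists2 s, s \in AutF F S & exists2 h,
    fusion_map 'N(U) [set: gT]%G h & {in U, h =1 s \o f}.
Proof.
move=> nS [Ff Ff' fK f'K]; have [sat1 sat2] := satF.
have [cS sylS] := sat1 S nS.
pose B : {set {perm gT}} := [set s in AutF F S | [exists g in 'N(U),
  [forall y in S, s y == f (f' y ^ g)]]].
have BP s : reflect (s \in AutF F S /\
    exists2 g, g \in 'N(U) & {in S, forall y, s y = f (f' y ^ g)}) (s \in B).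
  rewrite [X in reflect _ X]finset.in_set; apply: (iffP andP) => -[As].
    move=> /existsP[g /andP[Ng /forall_inP H]]; split=> //; exists g => // y Sy.
    exact/eqP/H.
  case=> g Ng H; split=> //; apply/existsP; exists g; rewrite Ng /=.
  by apply/forall_inP => y Sy; rewrite H.
have NU c x : c \in 'N(U) -> x \in U -> x ^ c \in U.
  by move=> Nc Ux; rewrite memJ_norm.
have f'U := fusion_map_mem Ff'.
have gB : group_set B.
  apply/group_setP; split=> [|s t /BP[As [g Ng sE]] /BP[At [h Nh tE]]].
    apply/BP; split; first exact: group1.
    by exists 1 => [|y Sy]; rewrite ?group1 // perm1 conjg1 f'K.
  apply/BP; split; first exact: groupM.
  exists (g * h) => [|y Sy]; first exact: groupM.
  rewrite permM sE // tE ?fK ?conjgM ?NU ?f'U //.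
  by apply: (fusion_map_mem Ff); rewrite NU ?f'U.
have pB : p.-group (Group gB).
  (* The exponent of [B] divides the order of the whole group. *)
  rewrite -pnat_exponent; apply: pnat_dvd pgT; apply/exponentP => s.
  move=> /BP[/AutFP[As _] [c Nc sE]].
  apply: (eq_Aut (groupX _ As) (group1 _)) => y Sy; rewrite perm1.
  have sXE k : (s ^+ k) y = f (f' y ^ (c ^+ k)).
    elim: k => [|k IH]; first by rewrite !expg0 perm1 conjg1 f'K.
    rewrite !expgSr permM IH sE ?fK ?conjgM ?NU ?groupX ?f'U //.
    by apply: (fusion_map_mem Ff); rewrite NU ?groupX ?f'U.
  by rewrite sXE expg_cardG ?inE // conjg1 f'K.
have sBA : Group gB \subset AutF F S.
  by apply/fintype.subsetP => s /BP[].
have [s As sBs] := Sylow_Jsub (G := AutF_group S) sylS sBA pB.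
exists s => //.
have [As' Fs] := AutFP _ _ As.
pose s' : {perm gT} := s^-1.
have [_ Fs'] := AutFP _ s' (groupVr As).
have isoU : fusion_iso U S (s \o f) (f' \o s').
  apply: (fusion_iso_comp (V := S)) => //.
  by split=> // x _; [exact: permK|exact: permKV].
have [[phi phiE] [psi psiE] phiK psiK] := isoU.
have inv : inverse_homs phi psi.
  split=> x; apply: val_inj.
    by change (sgval (psi (phi x)) = sgval x); rewrite psiE phiE phiK ?subgP.
  by change (sgval (phi (psi x)) = sgval x); rewrite phiE psiE psiK ?subgP.
have [ext extE] := sat2 _ _ phi psi inv cS.
have sNE : 'N(U) \subset extender phi.
  apply/fintype.subsetP => c Nc.
  have Fc : fusion_map S S (f \o (conjg^~ c \o f')).
    apply: fusion_map_comp Ff; apply: fusion_map_comp Ff' _.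
    by apply: fusion_map_conj => x Ux; exact: NU.
  have [t At tE] := fusion_auto Fc.
  have Bt : t \in B by apply/BP; split=> //; exists c.
  have /AutPP[_ [h Nh hE]] : t ^ s \in AutP S.
    by rewrite (fintype.subsetP sBs) ?memJ_conjg.
  apply/extenderP; split=> //; exists h => // x y xyE.
  have Ux := subgP x; have Sfx := fusion_map_mem Ff Ux.
  have -> : sgval (phi y) = s (t (f (sgval x))).
    by rewrite phiE xyE tE //= fK.
  rewrite -permJ hE ?phiE //.
  exact: fusion_map_mem Sfx.
exists (fun x => sgval (ext (subg (extender_group phi) x))).
  apply: (fusion_map_comp (fusion_map_sub sNE) (hom_fusion_map ext)).
move=> x Ux.
have Ex : x \in extender phi.
  by rewrite (fintype.subsetP sNE) ?(fintype.subsetP (normG U)).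
have := extE (subg U x) (subg (extender_group phi) x).
rewrite /inc /= !subgK // => /(_ erefl) <-.
by rewrite phiE subgK.
Qed.

(** When [q] is a homomorphism, this says that its kernel is strongly closed
    in [F]. *)
Definition preserves_fibres (A : Type) (q : gT -> A) : Prop :=
  forall U V f, fusion_map U V f ->
  {in U &, forall x y, q x = q y -> q (f x) = q (f y)}.

Variables (rT : finGroupType) (pi : {morphism [set: gT] >-> rT}).
Hypothesis pi_fibres : preserves_fibres pi.

Lemma fusion_map_ker U V f x :
  fusion_map U V f -> x \in U -> (pi (f x) == 1) = (pi x == 1).
Proof.
move=> Ff Ux; have [W [f' [Ff' Ff'' fK _]]] := fusion_map_corestr Ff.
have Wfx := fusion_map_mem Ff' Ux.
apply/eqP/eqP=> H.
  have := pi_fibres Ff'' Wfx (group1 W).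
  by rewrite fK // (fusion_map1 Ff'') morph1; apply.
have := pi_fibres Ff Ux (group1 U).
by rewrite (fusion_map1 Ff) morph1; apply.
Qed.

Hypothesis pi_p' : forall S s, s \in AutF F S -> p^'.-elt s ->
  {in S, forall x, pi (s x) = pi x}.

Let piJ x y : pi (x ^ y) = pi x ^ pi y.
Proof. by rewrite morphJ ?inE. Qed.

(** The normal subgroup [N] of Aut_F(S) acting trivially modulo the kernel
    contains all [p']-elements, so Aut_F(S) / N is a [p]-group and Aut_F(S) is
    the product of [N] and the Sylow subgroup Aut_P(S). *)
Lemma AutF_conj_mod S s : fully_normalized F S -> s \in AutF F S ->
  exists c, {in S, forall x, pi (s x) = pi (x ^ c)}.
Proof.
move=> nS As; have [sylS] : p.-Sylow(AutF F S) (AutP S).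
  by case: satF => /(_ S nS)[].
pose N : {set {perm gT}} :=
  [set t in AutF F S | [forall x in S, pi (t x) == pi x]].
have NP t : reflect (t \in AutF F S /\ {in S, forall x, pi (t x) = pi x})
    (t \in N).
  rewrite [X in reflect _ X]finset.in_set; apply: (iffP andP) => -[At].
    by move/forall_inP => H; split=> // x /H/eqP.
  by move=> H; split=> //; apply/forall_inP => x Sx; rewrite H.
have AS t x : t \in AutF F S -> x \in S -> t x \in S.
  by case/AutFP=> _ Ft Sx; exact: fusion_map_mem Ft _ Sx.
have gN : group_set N.
  apply/group_setP; split=> [|t u /NP[At tE] /NP[Au uE]].
    by apply/NP; split=> [|x _]; [exact: (group1 (AutF_group S))|rewrite perm1].
  apply/NP; split; first exact: (groupM (G := AutF_group S)).
  by move=> x Sx; rewrite permM uE ?AS // tE.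
have nN : Group gN <| AutF_group S.
  apply/andP; split; first by apply/fintype.subsetP => t /NP[].
  apply/fintype.subsetP => u Au; rewrite inE.
  apply/fintype.subsetP => _ /imsetP[t /NP[At tE] ->].
  have [_ Fu] := AutFP _ _ Au.
  apply/NP; split; first exact: (groupJ (G := AutF_group S)).
  move=> x Sx.
  have Au' : u^-1%g \in AutF F S by exact: (groupVr (G := AutF_group S)).
  have Sux := AS _ _ Au' Sx.
  rewrite -{1}(permKV u x) permJ -[in RHS](permKV u x).
  exact: pi_fibres Fu _ _ (AS _ _ At Sux) Sux (tE _ Sux).
have nNA := normal_norm nN.
have pAN : p.-group (AutF_group S / Group gN).
  apply/pgroupP => q pr_q /(Cauchy pr_q)[_ /morphimP[t Nt At ->] oq].
  have p't : t.`_p^' \in N.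
    have At' : t.`_p^' \in AutF_group S by exact: groupX.
    by apply/NP; split=> //; exact: pi_p' At' (p_elt_constt _ _).
  have ctE : coset (Group gN) t = coset (Group gN) t.`_p.
    rewrite -{1}(consttC p t) morphM ?(groupX _ Nt) //= (coset_id p't).
    exact: mulg1.
  have : p.-elt (coset (Group gN) t).
    by rewrite ctE; apply: morph_p_elt (p_elt_constt _ _); exact: groupX.
  by rewrite /p_elt oq pnatE.
have sTA : AutP S \subset AutF_group S by exact: pHall_sub sylS.
have /pHall_id/(_ pAN) eqT :=
  quotient_pHall (fintype.subset_trans sTA nNA) sylS.
have : AutF_group S \subset Group gN * AutP S.
  by rewrite -(quotientSK _ nNA) eqT.
move=> /fintype.subsetP/(_ s As).
move=> /mulsgP[t u /NP[At tE] /AutPP[_ [c Nc cE]] ->].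
by exists c => x Sx; rewrite permM cE ?AS //= !piJ tE.
Qed.

(** Descending induction on the order of [U].  Both [U] and [f @: U] are mapped
    to one fully normalized subgroup by isomorphisms which, by the induction
    hypothesis on the normalizers, are conjugations modulo the kernel. *)
Theorem fusion_map_conj_mod U V f : fusion_map U V f ->
  exists c, {in U, forall x, pi (f x) = pi (x ^ c)}.
Proof.
have [n] := ubnP (#|gT| - #|U|); elim: n => // n IH in U V f *.
move=> leUn Ff.
have base W S h h' :
    fully_normalized F S -> fusion_iso W S h h' -> #|W| = #|U| ->
    exists c, {in W, forall x, pi (h x) = pi (x ^ c)}.
  move=> nS hP cW; have [Fh _ _ _] := hP.
  have [s As [e Fe eE]] := extend_to_normalizer nS hP.
  have [c cE] := AutF_conj_mod nS As.
  have [d dE] : exists d, {in W, forall x, pi (s (h x)) = pi (x ^ d)}.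
    have [WT|nWT] := eqVneq W [set: gT]%G.
      (* The whole group has no larger normalizer, but then [S] is the whole
         group as well and the map is an element of Aut_F(S). *)
      have ST : S = [set: gT]%G.
        apply/val_inj/eqP; rewrite eqEcard finset.subsetT.
        by rewrite -(card_fusion_iso hP) WT /=.
      have Ft : fusion_map S S (s \o h).
        apply: fusion_map_comp (AutFP _ _ As).2; rewrite ST in Fh *.
        by rewrite WT in Fh.
      have [t At tE] := fusion_auto Ft.
      have [d dE] := AutF_conj_mod nS At; exists d => x Wx.
      have Sx : x \in S by rewrite ST inE.
      by rewrite -dE // tE.
    have ltWN : (#|W| < #|'N(W)|)%N.
      have := nilpotent_proper_norm (pgroup_nil pgT) (_ : W \proper [set: gT]).
      rewrite finset.setTI => /(_ _)/proper_card; apply.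
      rewrite finset.properEneq finset.subsetT andbT.
      by apply: contraNneq nWT => /val_inj ->.
    have ltNn : (#|gT| - #|'N(W)| < n)%N.
      rewrite -ltnS; apply: leq_trans leUn; rewrite !ltnS -cW ltn_sub2l //.
      by apply: leq_trans ltWN _; rewrite max_card.
    have [d dE] := IH _ _ _ ltNn Fe; exists d => x Wx; rewrite -dE ?eE //.
    by rewrite (fintype.subsetP (normG W)).
  exists (d * c^-1) => x Wx.
  rewrite conjgM piJ morphV ?inE // -dE // cE ?(fusion_map_mem Fh) // piJ.
  by rewrite -conjgM mulgV conjg1.
have [W [f' fP]] := fusion_map_corestr Ff.
have [S [h [h' [nS hP]]]] := ex_fully_normalized U.
have [g gE] := base _ _ _ _ nS hP erefl.
have [k kE] := base _ _ _ _ nS (fusion_iso_comp (fusion_iso_sym fP) hP)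
  (esym (card_fusion_iso fP)).
exists (g * k^-1) => x Ux; have [Ff' _ fK _] := fP.
rewrite conjgM piJ morphV ?inE // -gE //.
have := kE _ (fusion_map_mem Ff' Ux); rewrite /= fK // => ->.
by rewrite piJ -conjgM mulgV conjg1.
Qed.

End Control.

End FusionMaps.

(** * Dihedral images of a 2-group *)

(** The automorphism group of a cyclic 2-group is a 2-group: if [x <> 1], then
    [u] is odd, so in
    [u ^ n - 1 = (u - 1) (1 + u + .. + u ^ (n - 1))] the second factor is odd,
    and the order of [x] divides the first one. *)
Lemma odd_expg_fix (gT : finGroupType) (x : gT) u n :
  2.-elt x -> odd n -> x ^+ (u ^ n) = x -> x ^+ u = x.
Proof.
move=> /p_natP[s ox] odd_n.
have n_gt0 : (0 < n)%N by case: n odd_n.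
have [->|u_gt0] := posnP u.
  by rewrite exp0n // expg0 => <-; rewrite expg1n.
have modE k : (0 < k)%N -> (x ^+ k == x) = (2 ^ s %| k.-1)%N.
  move=> k_gt0; rewrite -{2}[x]expg1 eq_expg_mod_order ox eqn_mod_dvd //.
  by rewrite subn1.
move/eqP; rewrite modE ?expn_gt0 ?u_gt0 // => dv.
apply/eqP; rewrite modE //; case: s dv {ox modE} => [|s] dv; first exact: dvd1n.
have odd_u : odd u.
  have := dvdn_trans (dvdn_exp (isT : 0 < s.+1)%N (dvdnn 2)) dv.
  rewrite dvdn2 -subn1 oddB ?expn_gt0 ?u_gt0 // oddX.
  by rewrite eqn0Ngt n_gt0; case: (odd u).
rewrite predn_exp Gauss_dvdl // in dv; apply: coprimeXl; rewrite coprime2n.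
have -> : odd (\sum_(i < n) u ^ i) = odd n; last by [].
elim: (n) => [|k IHk]; first by rewrite big_ord0.
by rewrite big_ord_recr /= oddD IHk oddX odd_u orbT addbT.
Qed.

Section Dihedral.
Variables (gT rT lT : finGroupType) (F : fusion_system gT).
Variables (pi : {morphism [set: gT] >-> rT}).
Variables (rho : {morphism [set: rT] >-> lT}).
Hypotheses (pi_fibres : preserves_fibres F pi).
Hypotheses (rho_fibres : preserves_fibres F (rho \o pi)).
Variables a b t : rT.
Hypotheses (a2 : 2.-elt a) (ab : a ^ b = a^-1).
Hypothesis piE :
  forall x, pi x \in <[a]> \/ exists2 c, c \in <[a]> & pi x = c * b.
Hypotheses (rho_a : rho a ^+ 2 != 1).
Hypotheses (ta : t \in <[a]>) (rho_t : rho t = 1) (t2 : t ^+ 2 != 1).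
Implicit Types (U V S : {group gT}) (f : gT -> gT).

Let piM x y : pi (x * y) = pi x * pi y.
Proof. by rewrite morphM ?inE. Qed.
Let piV x : pi x^-1 = (pi x)^-1.
Proof. by rewrite morphV ?inE. Qed.
Let piX x n : pi (x ^+ n) = pi x ^+ n.
Proof. by rewrite morphX ?inE. Qed.

Lemma rotation_reflection x c :
  pi x \notin <[a]> -> c \in <[a]> -> c ^ pi x = c^-1.
Proof.
case: (piE x) => [->//|[d Ad ->] _ Ac].
have cA : abelian <[a]> := cycle_abelian a.
rewrite conjgM (conjgE c) (centsP cA _ Ac _ Ad) mulKg.
by have /cycleP[k ->] := Ac; rewrite conjXg ab expgVn.
Qed.

Lemma reflectionV x y :
  pi x \notin <[a]> -> pi y \notin <[a]> -> pi (x^-1 * y) \in <[a]>.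
Proof.
case: (piE x) => [->//|[c Ac xE]] nx.
case: (piE y) => [->//|[d Ad yE]] _.
have Acd : c^-1 * d \in <[a]> by rewrite groupM ?groupV.
rewrite piM piV xE yE invMg -mulgA (mulgA c^-1) -conjgE.
by have /cycleP[k ->] := Acd; rewrite conjXg ab expgVn groupV mem_cycle.
Qed.

(** A reflection in the kernel of [rho] would make [rho a] its own inverse. *)
Lemma ker_rotation x : rho (pi x) = 1 -> pi x \in <[a]>.
Proof.
move=> rx1; apply: contraR rho_a => /rotation_reflection/(_ (cycle_id a)) aE.
have : rho (a ^ pi x) = rho a by rewrite morphJ ?inE // rx1 conjg1.
rewrite aE morphV ?inE // => raV.
by rewrite expgS expg1 -{1}raV mulVg.
Qed.

(** The heart of the matter: the strongly closed kernel of [rho \o pi] does not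
    let fusion move a rotation to a reflection. *)
Lemma fusion_rotation U V f x :
  fusion_map F U V f -> x \in U -> pi x \in <[a]> -> pi (f x) \in <[a]>.
Proof.
move=> Ff Ux Ax.
have [r1|r1] := eqVneq (rho (pi x)) 1.
  apply: ker_rotation.
  have := rho_fibres Ff Ux (group1 U).
  by rewrite /= (fusion_map1 Ff) !morph1; apply.
(* Of the subgroups generated by [pi x] and [t] one contains the other, and
   only [t] is killed by [rho]. *)
have [k tE] : exists k, t = pi x ^+ k.
  apply/cycleP; rewrite -cycle_subG.
  have sxa : <[pi x]> \subset <[a]> by rewrite cycle_subG.
  have sta : <[t]> \subset <[a]> by rewrite cycle_subG.
  have cyc := cycle_cyclic a.
  have /p_natP[i oi] := mem_p_elt a2 Ax; have /p_natP[j oj] := mem_p_elt a2 ta.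
  case: (leqP j i) => [le|/ltnW le].
    by rewrite -(cardSg_cyclic cyc) // -!orderE oi oj dvdn_exp2l.
  have /cycleP[l xE] : pi x \in <[t]>.
    rewrite -cycle_subG.
    by rewrite -(cardSg_cyclic cyc) // -!orderE oi oj dvdn_exp2l.
  case/eqP: r1.
  by rewrite xE morphX ?inE // rho_t expg1n.
have Uxk : x ^+ k \in U by rewrite groupX.
have Axk : pi (f (x ^+ k)) \in <[a]>.
  apply: ker_rotation.
  have := rho_fibres Ff Uxk (group1 U).
  by rewrite /= (fusion_map1 Ff) !morph1; apply; rewrite piX -tE.
(* If [pi (f x)] were a reflection, it would invert the rotation
   [pi (f (x ^+ k))], with which it commutes; but the square of that rotation
   is the image of [t ^+ 2], which is not 1. *)
apply: contraR t2 => /rotation_reflection/(_ Axk) sE.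
have : pi (f (x ^+ k)) ^ pi (f x) = pi (f (x ^+ k)).
  rewrite (fusion_mapX _ Ff) // piX; apply/conjg_fixP; apply/commgP.
  by apply/commute_sym/commuteX.
rewrite sE => sV.
rewrite tE -!piX -(fusion_map_ker pi_fibres Ff) ?groupX //.
by rewrite (fusion_mapX _ Ff) // piX expgS expg1 -{1}sV mulVg.
Qed.

Lemma odd_fusion_auto S s : s \in AutF F S -> 2^'.-elt s ->
  {in S, forall x, pi (s x) = pi x}.
Proof.
move=> As s2'.
have odd_n : odd #[s] by move: s2'; rewrite /p_elt p'natE // dvdn2 negbK.
have Fs k : fusion_map F S S (s ^+ k)%g.
  have /AutFP[] // : (s ^+ k)%g \in AutF F S.
  exact: (groupX (G := AutF_group F S)).
have Ss k x : x \in S -> (s ^+ k)%g x \in S.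
  by move=> Sx; exact: fusion_map_mem (Fs k) _ Sx.
have Fs1 : fusion_map F S S s by case/AutFP: As.
have rot x : x \in S -> pi x \in <[a]> -> pi (s x) = pi x.
  move=> Sx Ax; have Asx := fusion_rotation Fs1 Sx Ax.
  (* In a cyclic group elements of equal order generate the same subgroup. *)
  have [u uE] : exists u, pi (s x) = pi x ^+ u.
    apply/cycleP; suff <- : <[pi (s x)]> = <[pi x]> by exact: cycle_id.
    apply/eqP; rewrite (eq_subG_cyclic (cycle_cyclic a)) ?cycle_subG //.
    have kE n : (pi (s x) ^+ n == 1) = (pi x ^+ n == 1).
      rewrite -!piX -(fusion_mapX _ Fs1) //.
      by rewrite (fusion_map_ker pi_fibres Fs1) ?groupX.
    rewrite -!orderE eqn_dvd !order_dvdn kE expg_order eqxx.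
    by rewrite -kE expg_order /=.
  have sXE k : pi ((s ^+ k)%g x) = pi x ^+ (u ^ k).
    elim: k => [|k IHk]; first by rewrite expg0 perm1 expg1.
    rewrite expgSr permM; have Sskx := Ss k _ Sx.
    have := pi_fibres Fs1 Sskx (groupX (u ^ k) Sx).
    rewrite piX => ->; last exact: IHk.
    by rewrite (fusion_mapX _ Fs1) // piX uE -expgM -expnS.
  rewrite uE; apply: (odd_expg_fix (mem_p_elt a2 Ax) odd_n).
  by rewrite -sXE expg_order perm1.
move=> x Sx; have [Ax|nAx] := boolP (pi x \in <[a]>); first exact: rot.
have nAsx : pi (s x) \notin <[a]>.
  apply: contra nAx => Asx; have rotX k : pi ((s ^+ k.+1)%g x) = pi (s x).
    elim: k => // k IHk; rewrite expgSr permM rot ?IHk //; exact: Ss.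
  by rewrite -[x in pi x](perm1 x) -(expg_order s) -(prednK (order_gt0 s)) rotX.
(* [s x] and [x] differ by the rotation [pi y], which [s] fixes; so the [k]-th
   power of [s] multiplies [pi x] by [pi y ^+ k], and the 2-element [pi y] is
   killed by the odd order of [s]. *)
pose y := x^-1 * s x.
have Sy : y \in S by rewrite groupM ?groupV // (fusion_map_mem Fs1).
have Ay : pi y \in <[a]> by exact: reflectionV.
have sxE : s x = x * y by rewrite mulKVg.
have sXy k : pi ((s ^+ k)%g y) = pi y.
  elim: k => [|k IHk]; first by rewrite expg0 perm1.
  by rewrite expgSr permM rot ?IHk // Ss.
have sXx k : pi ((s ^+ k)%g x) = pi x * pi y ^+ k.
  elim: k => [|k IHk]; first by rewrite expg0 perm1 expg0 mulg1.
  rewrite expgS permM sxE (fusion_mapM (Fs k)) // piM IHk sXy.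
  by rewrite expgSr mulgA.
have : pi y ^+ #[s] == 1.
  by rewrite -(inj_eq (mulgI (pi x))) -sXx expg_order perm1 mulg1.
rewrite -order_dvdn => dv; rewrite sxE piM.
suff : pi y == 1 by move/eqP ->; rewrite mulg1.
rewrite -order_eq1 -dvdn1; have := pnat_coprime (mem_p_elt a2 Ay) s2'.
by rewrite /coprime => /eqP <-; rewrite dvdn_gcd dvdnn.
Qed.

Theorem dihedral_fusion_map_conj U V f :
  2.-group [set: gT] -> saturated 2 F -> fusion_map F U V f ->
  exists c, {in U, forall x, pi (f x) = pi (x ^ c)}.
Proof.
move=> pgT satF; apply: (fusion_map_conj_mod pgT satF pi_fibres).
exact: odd_fusion_auto.
Qed.

End Dihedral.

(** * Compactness of inverse limits of finite groups *)

Local Open Scope classical_set_scope.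

Section InverseLimits.
Variables (d : Order.disp_t) (I : preorderType d) (Q : inverse_system I).
Hypothesis dirI : directed I.
Implicit Types (i j k : I) (x y : invlim Q).

Fact invlim_proj_div i : {morph @invlim_proj d I Q i : x y / x * y^-1}.
Proof. by []. Qed.

HB.instance Definition _ i :=
  isGroupMorphism.Build (invlim Q) (Q i) (@invlim_proj d I Q i)
    (@invlim_proj_div i).

Lemma invlim_projX i x n : invlim_proj i (x ^+ n) = invlim_proj i x ^+ n.
Proof. exact: gmulfXn. Qed.

Lemma invlim_projV i x : invlim_proj i x^-1 = (invlim_proj i x)^-1.
Proof. exact: gmulfV. Qed.

Lemma invlim_projJ i x y :
  invlim_proj i (x ^ y) = invlim_proj i x ^ invlim_proj i y.
Proof. exact: gmulfJ. Qed.

Lemma invlim_ext x y : (forall i, invlim_proj i x = invlim_proj i y) -> x = y.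
Proof.
move=> xy; apply/val_inj; apply: functional_extensionality_dep => i.
exact: xy.
Qed.

Lemma invlim_proj_neq1 x : x <> 1 -> exists i, invlim_proj i x != 1.
Proof.
move=> x1; apply: contrapT => none; apply: x1; apply: invlim_ext => i.
rewrite gmulf1; apply/eqP; apply: contrapT => xi.
by apply: none; exists i; apply/negP.
Qed.

Lemma invlim_proj_map i j (le_ij : (i <= j)%O) x :
  is_map Q le_ij (invlim_proj j x) = invlim_proj i x.
Proof. by have := set_mem (svalP x) => /(_ i j le_ij). Qed.

Lemma invlim_mk (z : forall i, Q i) :
  (forall i j (le_ij : (i <= j)%O), is_map Q le_ij (z j) = z i) ->
  exists x : invlim Q, forall i, invlim_proj i x = z i.
Proof.
move=> zP; have zQ : (z : prod_grp Q) \in @invlim_set d I Q by apply/mem_set.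
by exists (exist (fun z => z \in @invlim_set d I Q) _ zQ).
Qed.

(** Every family with finite values has a limit along an ultrafilter that
    contains all tails of the index set, and coherence holds in the limit
    because two sets of the ultrafilter meet.  This form of compactness avoids
    arguments with closed subsets of the product. *)
Lemma invlim_cofinal (y : forall k, Q k) :
  exists x : invlim Q, forall i, exists k (le_ik : (i <= k)%O),
    is_map Q le_ik (y k) = invlim_proj i x.
Proof.
have [[i0] dir] := dirI.
pose tails : set_system I := [set A | exists k0, forall k, (k0 <= k)%O -> A k].
have tails_filter : ProperFilter tails.
  apply: Build_ProperFilter.
    by move=> [k0 /(_ k0 (lexx k0))].
  split.
  - by exists i0.
  - move=> A B [k Ak] [l Bl]; have [m [km lm]] := dir k l.
    exists m => n mn.
    by split; [apply/Ak/(le_trans km)|apply/Bl/(le_trans lm)].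
  - by move=> A B sAB [k Ak]; exists k => l kl; apply/sAB/Ak.
have [G [GU tailsG]] := ultraFilterLemma tails_filter.
pose fib i (v : Q i) : set I :=
  [set k | exists le_ik : (i <= k)%O, is_map Q le_ik (y k) = v].
have lim i : exists v, G (fib i v).
  apply: contrapT => none.
  have /filter_ex[k [kN ik]] :
      G ((fun k => forall v, ~ fib i v k) `&` [set k | (i <= k)%O]).
    apply: filterI; last by apply: tailsG; exists i.
    apply: filter_forall => v.
    have [Gv|//] := in_ultra_setVsetC (fib i v) GU.
    by case: none; exists v.
  by apply: (kN (is_map Q ik (y k))); exists ik.
pose z i := projT1 (cid (lim i)).
have zP i : G (fib i (z i)) := projT2 (cid (lim i)).
have [|x xE] := @invlim_mk z.
  move=> i j le_ij; have /filter_ex[k [[ik <-] [jk <-]]] :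
    G (fib i (z i) `&` fib j (z j)) by exact: filterI.
  exact: is_map_comp.
exists x => i; have /filter_ex[k [ik kE]] := zP i.
by exists k, ik; rewrite xE.
Qed.

Lemma mittag_leffler i : exists j (le_ij : (i <= j)%O),
  forall y : Q j, exists x : invlim Q, is_map Q le_ij y = invlim_proj i x.
Proof.
apply: contrapT => none.
have bad j : exists y : Q j, forall le_ij : (i <= j)%O,
    ~ exists x : invlim Q, is_map Q le_ij y = invlim_proj i x.
  have [le_ij|nle] := pselect (i <= j)%O; last by exists 1.
  apply: contrapT => nbad; case: none; exists j, le_ij => y.
  apply: contrapT => nx; apply: nbad; exists y => le_ij'.
  by have -> : le_ij' = le_ij by exact: bool_irrelevance.
have [x xP] := invlim_cofinal (fun j => projT1 (cid (bad j))).
have [k [ik kE]] := xP i.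
by case: (projT2 (cid (bad k)) ik); exists x.
Qed.

(** One coordinate suffices for a basic neighbourhood, as [I] is directed. *)
Lemma open_cylinder (A : set (invlim Q)) x : open A -> A x ->
  exists i, forall y, invlim_proj i y = invlim_proj i x -> A y.
Proof.
have [[i0] dir] := dirI.
move=> [B oB <-] Bx.
pose cyl : set_system (prod_grp Q) := [set C | exists i, forall y,
  invlim_proj i y = invlim_proj i x -> C (val y)].
have fcyl : Filter cyl.
  split.
  - by exists i0.
  - move=> C D [i Ci] [j Dj]; have [k [ik jk]] := dir i j.
    exists k => y yx; split; [apply: Ci|apply: Dj].
      by rewrite -!(invlim_proj_map ik) yx.
    by rewrite -!(invlim_proj_map jk) yx.
  - by move=> C D sCD [i Ci]; exists i => y yx; apply/sCD/Ci.
have : cyl --> (val x : prod_grp Q).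
  apply/cvg_sup => i C /=.
  rewrite (@nbhsE (initial_topology (fun f : prod_grp Q => f i))).
  move=> -[_ [[D oD <-] Dx] sDC].
  by exists i => y yx; apply: sDC; rewrite /preimage /= [X in D X]yx.
by apply; exact: open_nbhs_nbhs.
Qed.

End InverseLimits.

(** * Limits of saturated systems with dihedral limit group *)

Lemma functor_over_fiber (G G' : Type) (alpha : G -> G')
    (O : subgroup_family G) (O' : subgroup_family G')
    (C : subgroup_category O) (C' : subgroup_category O')
    (Phi : functor_over alpha C C') (R : O) (x : el R) :
  exists y : el (Phi R), inc y = alpha (inc x).
Proof.
have : (alpha @` range (@inc _ _ R)) (alpha (inc x)).
  by exists (inc x) => //; exists x.
by rewrite -(fo_obj Phi) => -[y _ yE]; exists y.
Qed.

Section FusionLimits.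
Variables (d : Order.disp_t) (I : preorderType d) (Q : inverse_system I).
Variable (FQ : fusion_inverse_system Q).
Implicit Types (i j k : I) (x y g : invlim Q).
Implicit Types R S : closed_subgroup (invlim Q).

Lemma is_map_fibres i j (le_ij : (i <= j)%O) :
  preserves_fibres (FQ j) (is_map Q le_ij).
Proof.
move=> U V f [phi phiE] x x' Ux Ux' xx'.
have [y yE] :=
  functor_over_fiber (fis_fun FQ le_ij) (subg U x : el (U : subgroups _)).
have := fo_comm phi yE.
have yE' : inc y = is_map Q le_ij (inc (subg U x' : el (U : subgroups _))).
  by rewrite yE /inc /= !subgK.
by rewrite (fo_comm phi yE') /inc /= !phiE !subgK.
Qed.

Lemma lim_Hom_fusion_map R S (fam : lim_Hom FQ R S)
    (phi : el (R : closed_subgroups _) -> el (S : closed_subgroups _)) i :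
  induces fam phi ->
  exists2 f, fusion_map (FQ i) (image_group i R) (image_group i S) f &
    forall u, invlim_proj i (inc (phi u)) = f (invlim_proj i (inc u)).
Proof.
move=> famP; eexists; first exact: (hom_fusion_map (fam i)).
move=> x /=; have /(congr1 sgval) := famP i x; rewrite /= => ->.
congr (sgval (fam i _)); apply: val_inj.
change (invlim_proj i (inc x) =
  sgval (subg (image_group i R) (invlim_proj i (inc x)))).
by rewrite subgK //; exact: mem_image_group.
Qed.

Lemma conj_lim_hom R S g
    (phi : el (R : closed_subgroups _) -> el (S : closed_subgroups _)) :
  (forall u, inc (phi u) = inc u ^ g) -> lim_hom FQ phi.
Proof.
move=> phiE.
have mem i (u : subg_of (image_group i R)) :
    sgval (subg (image_group i S) (sgval u ^ invlim_proj i g)) =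
    sgval u ^ invlim_proj i g.
  rewrite subgK //; have /image_setP[x Rx <-] := subgP u.
  pose v : el (R : closed_subgroups _) := exist _ x (mem_set Rx).
  have -> : invlim_proj i x ^ invlim_proj i g = invlim_proj i (inc (phi v)).
    by rewrite phiE invlim_projJ.
  exact: mem_image_group.
pose fam i : Hom (FQ i) (image_group i R) (image_group i S) :=
  MkHom (fs_conj (FQ i) (@mem i)).
have famP i j (le_ij : (i <= j)%O) :
    same_map (functor_map (fis_fun FQ le_ij) (fam j)) (fam i).
  move=> x x' xx'.
  have : range (@inc _ _ (fis_fun FQ le_ij (image_group j R))) (inc x).
    by exists x.
  rewrite fo_obj => -[_ [y _ <-] yx].
  rewrite (fo_comm (fam j) (esym yx)).
  have -> : inc (fam i x') = inc x ^ invlim_proj i g.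
    by rewrite xx'; exact: mem.
  have -> : inc (fam j y) = inc y ^ invlim_proj j g by exact: mem.
  by rewrite morphJ ?inE // yx invlim_proj_map.
exists (LimHom famP) => i u; apply: val_inj.
change (invlim_proj i (inc (phi u)) = sgval (fam i (to_image i u))).
by rewrite mem phiE; exact: invlim_projJ.
Qed.

Variables a b : invlim Q.
Hypothesis dirI : directed I.
Hypotheses (p2 : forall i, 2.-group [set: Q i]%SET /\ saturated 2 (FQ i)).
Hypotheses (ab : a ^ b = a^-1).
Hypothesis a_inf : forall n, (0 < n)%N -> a ^+ n <> 1.
Hypothesis abE : forall i x, exists (n : nat) (e : bool),
  invlim_proj i x = invlim_proj i (a ^+ n * b ^+ e).

(** The finite part is applied to [Q j -> Q i' -> Q i0]: the square of [a] is
    visible in [Q i0], the rotation [t = a ^+ m] dies in [Q i0] but its square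
    survives in [Q i'], and [Q j] has a dihedral image in [Q i']. *)
Lemma lim_hom_level_conj R S (fam : lim_Hom FQ R S)
    (phi : el (R : closed_subgroups _) -> el (S : closed_subgroups _)) i :
  induces fam phi ->
  exists c : Q i, forall u,
    invlim_proj i (inc (phi u)) = invlim_proj i (inc u) ^ c.
Proof.
move=> famP; have [_ dir] := dirI.
have [i0 a2] := invlim_proj_neq1 (a_inf (isT : 0 < 2)%N).
pose m := #[invlim_proj i0 a].
have [i1 am] : exists i1, invlim_proj i1 (a ^+ (m * 2)) != 1.
  by apply: invlim_proj_neq1; apply: a_inf; rewrite muln_gt0 order_gt0.
have [i2 [ii2 i02]] := dir i i0; have [i' [i2i' i1i']] := dir i2 i1.
have ii' := le_trans ii2 i2i'; have i0i' := le_trans i02 i2i'.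
have [j [i'j surj]] := mittag_leffler Q dirI i'.
have [f Ff fE] := lim_Hom_fusion_map j famP.
have [c cE] : exists c, {in image_group j R, forall u,
    is_map Q i'j (f u) = is_map Q i'j (u ^ c)}.
  have [pj satj] := p2 j.
  apply: (@dihedral_fusion_map_conj _ _ _ (FQ j) (is_map Q i'j)
    (is_map Q i0i') _ _ (invlim_proj i' a) (invlim_proj i' b)
    (invlim_proj i' a ^+ m) _ _ _ _ _ _ _ _ _ _ pj satj Ff).
  - exact: is_map_fibres.
  - have i0j := le_trans i0i' i'j.
    move=> U V g Fg x y Ux Uy; rewrite /= !(is_map_comp _ _ i0j).
    exact: is_map_fibres Fg _ _ Ux Uy.
  - by have [pi' _] := p2 i'; apply: mem_p_elt pi' _; rewrite inE.
  - by rewrite -invlim_projJ ab invlim_projV.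
  - move=> x; have [y ->] := surj x; have [k [e ->]] := abE i' y.
    rewrite invlim_projM !invlim_projX; case: e => /=.
      by right; exists (invlim_proj i' a ^+ k); rewrite ?mem_cycle.
    by left; rewrite mulg1 mem_cycle.
  - by rewrite invlim_proj_map -invlim_projX.
  - exact: mem_cycle.
  - by rewrite morphX ?inE // invlim_proj_map expg_order.
  - apply: contra am => /eqP am; rewrite -(invlim_proj_map i1i') invlim_projX.
    by rewrite expgnA am morph1.
exists (is_map Q ii' (is_map Q i'j c)) => x.
have ij := le_trans ii' i'j.
rewrite -!(invlim_proj_map ij) fE.
have jx : invlim_proj j (inc x) \in image_group j R by exact: mem_image_group.
rewrite -!(is_map_comp ii' i'j ij) cE //.
by rewrite morphJ ?inE // morphJ ?inE.
Qed.

Theorem lim_hom_conj R S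
    (phi : el (R : closed_subgroups _) -> el (S : closed_subgroups _)) :
  lim_hom FQ phi -> exists g, forall u, inc (phi u) = inc u ^ g.
Proof.
move=> [fam famP].
pose c i := projT1 (cid (lim_hom_level_conj i famP)).
have cE i u : invlim_proj i (inc (phi u)) = invlim_proj i (inc u) ^ c i.
  exact: (projT2 (cid (lim_hom_level_conj i famP))).
have [g gP] := invlim_cofinal dirI c; exists g => u; apply: invlim_ext => i.
have [k [ik gE]] := gP i.
by rewrite invlim_projJ -gE -!(invlim_proj_map ik) cE morphJ ?inE.
Qed.

End FusionLimits.

(** * Invariance under isomorphism of pro-fusion systems *)

Lemma subgroup_category_eq (G : Type) (O : subgroup_family G)
    (C C' : subgroup_category O) :
  (forall R S phi, hom C R S phi <-> hom C' R S phi) -> C = C'.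
Proof.
case: C C' => [h hid hcomp] [h' hid' hcomp'] /= hh'.
have E : h = h'.
  apply: functional_extensionality_dep => R.
  apply: functional_extensionality_dep => S.
  by apply/funext => phi; apply/propext.
case: _ / E in hid' hcomp' hh' *.
by congr SubgroupCategory; exact: Prop_irrelevance.
Qed.

Lemma inc_mem (P : topologicalGroupType) (R : closed_subgroup P)
  (x : el (R : closed_subgroups P)) : cs_set R (inc x).
Proof. exact: (set_mem (svalP x)). Qed.

Lemma conj_homP (P : topologicalGroupType) (R S : closed_subgroups P)
    (phi : el R -> el S) :
  conj_hom phi <-> exists g, forall x, inc (phi x) = inc x ^ g.
Proof.
split=> [[g [_ gE]]|[g gE]]; exists g => //; split=> // x Rx.
have <- : inc (phi (exist _ x (mem_set Rx))) = x ^ g by rewrite gE.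
exact: inc_mem.
Qed.

Fact pro_morphism_div (P P' : topologicalGroupType)
    (F : subgroup_category (closed_subgroups P))
    (F' : subgroup_category (closed_subgroups P')) (al : pro_morphism F F') :
  {morph (al : P -> P') : x y / x * y^-1}.
Proof.
move=> x y; rewrite pm_morph; congr (_ * _).
have al1 : al 1 = 1 by apply: (mulgI (al 1)); rewrite -pm_morph !mulg1.
by apply: (mulgI (al y)); rewrite -pm_morph !mulgV.
Qed.

HB.instance Definition _ P P' F F' (al : @pro_morphism P P' F F') :=
  isGroupMorphism.Build P P' (al : P -> P') (pro_morphism_div al).

Section ProMorphisms.
Variables (P P' : topologicalGroupType).
Variables (F : subgroup_category (closed_subgroups P)).
Variables (F' : subgroup_category (closed_subgroups P')).
Variable al : pro_morphism F F'.

Lemma pro_morphism1 : al 1 = 1.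
Proof. exact: (gmulf1 (s := al)). Qed.

Lemma pro_morphismX n x : al (x ^+ n) = al x ^+ n.
Proof. exact: gmulfXn. Qed.

Lemma pro_morphismV x : al x^-1 = (al x)^-1.
Proof. exact: gmulfV. Qed.

Lemma pro_morphismJ x y : al (x ^ y) = al x ^ al y.
Proof. exact: gmulfJ. Qed.

End ProMorphisms.

Lemma pro_iso_conj (P P' : topologicalGroupType)
    (F : subgroup_category (closed_subgroups P))
    (F' : subgroup_category (closed_subgroups P'))
    (al : pro_morphism F F') (be : pro_morphism F' F) :
  pro_cancel al be -> F' = conj_category P' -> F = conj_category P.
Proof.
move=> [albe objK _] F'E.
have F'P (T U : closed_subgroups P') (psi : el T -> el U) :
    hom F' T U psi <-> exists g, forall y, inc (psi y) = inc y ^ g.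
  by rewrite F'E; exact: conj_homP.
apply: subgroup_category_eq => R S phi; split=> [Fphi|].
  pose phiH := MkHom Fphi.
  have [g gE] := (F'P _ _ _).1 (hom_funP (functor_map (pm_fun al) phiH)).
  apply/conj_homP; exists (be g) => x.
  have [y yE] := functor_over_fiber (pm_fun al) x.
  have := fo_comm phiH yE; rewrite gE yE => /(congr1 be) E.
  by rewrite -[LHS]albe -E pro_morphismJ albe.
case=> g [_ gE].
(* Conjugation by [al g] between the images of [R] and [S] belongs to [F'];
   its image under the inverse isomorphism is [phi]. *)
have conjP (y : el (pm_fun al R)) :
    exists z : el (pm_fun al S), inc z = inc y ^ al g.
  have : range (@inc _ _ (pm_fun al R)) (inc y) by exists y.
  rewrite fo_obj => -[_ [x _ <-] <-].
  have [z zE] := functor_over_fiber (pm_fun al) (phi x).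
  by exists z; rewrite zE gE pro_morphismJ.
pose psi y := projT1 (cid (conjP y)).
have psiE y : inc (psi y) = inc y ^ al g := projT2 (cid (conjP y)).
have Fpsi : hom F' _ _ psi by apply/F'P; exists (al g).
pose theta := functor_map (pm_fun be) (MkHom Fpsi).
have thetaE z : inc (theta z) = inc z ^ g.
  have : range (@inc _ _ (pm_fun be (pm_fun al R))) (inc z) by exists z.
  rewrite fo_obj => -[_ [y _ <-] yz].
  rewrite (fo_comm (MkHom Fpsi) (esym yz)) -yz.
  have -> : inc (MkHom Fpsi y) = inc y ^ al g by exact: psiE.
  by rewrite pro_morphismJ albe.
move: theta thetaE; move: (pm_fun be _) (objK R) (pm_fun be _) (objK S).
move=> R' -> S' -> theta thetaE.
suff -> : phi = theta by exact: hom_funP.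
by apply/funext => x; apply: val_inj; rewrite [LHS]gE [RHS]thetaE.
Qed.

(** * The infinite dihedral pro-2 group *)

Lemma nat_directed : directed nat.
Proof.
split; first exact: inhabits 0%N.
by move=> m n; exists (maxn m n); rewrite !leEnat leq_maxl leq_maxr.
Qed.

Lemma dih_aJb n : dih_a n ^ dih_b n = (dih_a n)^-1.
Proof.
have [_ b2 baba] := dih_relations n.
have bV : (dih_b n)^-1 = dih_b n by apply: mulg1_eq; rewrite -expg2.
apply/esym; apply: mulg1_eq; apply: (mulgI (dih_b n)).
by rewrite conjgE bV !mulgA baba mul1g mulg1.
Qed.

Lemma dih_aX_neq1 n k : (0 < k < 2 ^ n)%N -> dih_a n ^+ k <> 1.
Proof.
move=> /andP[k_gt0 k_lt]; rewrite dih_aX.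
move=> /(congr1 (fun z : dihedral2 n => val z.1)) E.
have {E} k0 : (k %% (2 ^ n).-1.+1 = 0)%N by exact: E.
rewrite prednK ?expn_gt0 // in k0; rewrite (modn_small k_lt) in k0.
by rewrite k0 in k_gt0.
Qed.

Lemma D2oo_gens : exists a b : D2oo, forall n,
  invlim_proj n a = dih_a n /\ invlim_proj n b = dih_b n.
Proof.
have [|a aE] := @invlim_mk _ _ dihedral_system dih_a.
  by move=> n m le_nm; exact: dih_proj_a.
have [|b bE] := @invlim_mk _ _ dihedral_system dih_b.
  by move=> n m le_nm; exact: dih_proj_b.
by exists a, b.
Qed.

Theorem proposition5p1 (F : subgroup_category (closed_subgroups D2oo)) :
  pro_fusion_system 2 F -> pro_saturated 2 F -> F = conj_category D2oo.
Proof.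
move=> _ [d [I [Q [FQ [dirI p2 [al [be [alK [beal _ _]]]]]]]]].
have [a [b abE]] := D2oo_gens; have [albe _ _] := alK.
apply: (pro_iso_conj alK).
have ab : al a ^ al b = (al a)^-1.
  rewrite -pro_morphismJ -pro_morphismV; congr (al _).
  apply: invlim_ext => n; rewrite invlim_projJ invlim_projV.
  by have [-> ->] := abE n; exact: dih_aJb.
have a_inf n : (0 < n)%N -> al a ^+ n <> 1.
  move=> n_gt0 aX; have : a ^+ n = 1.
    by rewrite -[LHS]albe -[RHS]albe pro_morphismX aX pro_morphism1.
  move=> /(congr1 (invlim_proj n)); rewrite invlim_projX (abE n).1.
  have -> : invlim_proj n (1 : D2oo) = 1 by exact: gmulf1.
  by apply: dih_aX_neq1; rewrite n_gt0 ltn_expl.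
(* The preimage of a point of [Q i] in the dihedral group is open, so it
   contains with [be x] all elements of equal image in some finite dihedral
   quotient, among them a product of powers of [a] and [b]. *)
have gen i (x : invlim Q) : exists (n : nat) (e : bool),
    invlim_proj i x = invlim_proj i (al a ^+ n * al b ^+ e).
  pose O := [set y : D2oo | invlim_proj i (al y) = invlim_proj i x].
  have oO : open O.
    have /continuousP := @pm_continuous _ _ _ _ al.
    by move=> /(_ _ (open_invlim_proj [set invlim_proj i x])).
  have Ox : O (be x) by rewrite /O /= beal.
  have [n nP] := open_cylinder nat_directed oO Ox.
  pose z : dihedral2 n := invlim_proj n (be x).
  exists (nat_of_ord z.1), z.2; apply/esym.
  rewrite -[_ * _]/(al a ^+ z.1 * al b ^+ z.2).
  have <- : al (a ^+ z.1 * b ^+ z.2) = al a ^+ z.1 * al b ^+ z.2.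
    by rewrite pm_morph !pro_morphismX.
  apply: nP; have [aE bE] := abE n.
  by rewrite invlim_projM !invlim_projX aE bE -dih_eltE.
apply: subgroup_category_eq => R S phi; split=> /=.
  move=> /(lim_hom_conj dirI p2 ab a_inf gen)[g gE].
  by apply/conj_homP; exists g.
by case=> g [_ gE]; exact: conj_lim_hom gE.
Qed.
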